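(* Let $X$ be a Tychonoff space with weight $w(X)$, and let $\mathcal C$ be the class of Baire metrizable spaces of density $\le w(X)$. Assume that $X$ is $\mathcal C$-Piotrowski. Then $X$ contains a dense completely metrizable subspace if and only if $X$ is Choquet.
   Context: A topological space is Baire if the intersection of any sequence of its open dense subsets is dense. A function $f:Z\to X$ between topological spaces is quasicontinuous if for every $z\in Z$, every neighborhood $O_z$ of $z$ in $Z$ and every neighborhood $O_{f(z)}$ of $f(z)$ in $X$ there is a non-empty open set $U\subset O_z$ with $f(U)\subset O_{f(z)}$. For a class $\mathcal C$ of Baire spaces, a topological space $X$ is $\mathcal C$-Piotrowski if every quasicontinuous map $f:C\to X$ defined on a non-empty space $C\in\mathcal C$ has a continuity point. The weight $w(X)$ is the smallest cardinality of a base of the topology; the density of a space is the smallest cardinality of a dense subset. A topological space is completely metrizable if it is homeomorphic to a complete metric space. The Choquet game on a topological space $X$ is played by two players $\alpha$ and $\beta$ who alternately select non-empty open subsets of $X$. Player $\alpha$ starts with $U_0=X$; player $\beta$ answers with a non-empty open set $V_0\subset U_0$. At the $n$-th move $\alpha$ chooses a non-empty open set $U_n\subset V_{n-1}$ and $\beta$ answers with a non-empty open set $V_n\subset U_n$. Player $\alpha$ wins if $\bigcap_{n\in\omega}U_n\neq\emptyset$; otherwise $\beta$ wins. The space $X$ is Choquet if player $\alpha$ has a winning strategy in the Choquet game on $X$. *)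

(* Defs.v *)
From HB Require Import structures.
From mathcomp Require Import all_boot all_order all_algebra.
From mathcomp Require Import all_classical all_reals all_analysis.

Set Implicit Arguments.
Unset Strict Implicit.
Unset Printing Implicit Defensive.

Local Open Scope classical_set_scope.
Local Open Scope card_scope.

(* Any nonempty family of sets has a member of least cardinality: a maximal
   family of choice functions that are pairwise distinct at every index
   projects onto some member and injects into all of them. *)
Lemma card_min_exists (U : Type) (F : set (set U)) :
  F !=set0 -> exists2 A, F A & forall B, F B -> A #<= B.
Proof.
move=> F0.
pose P := [set S : set (F -> U) |
  (forall f, S f -> forall i, (set_val i) (f i)) /\
  (forall f g i, S f -> S g -> f i = g i -> f = g)].
have [S [[Sin Sinj] Smax]] : exists S, P S /\ forall S', S `<` S' -> ~ P S'.
  apply: Zorn_bigcup => G GP Gtot; split.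
    by move=> f [S GS Sf] i; exact: (GP _ GS).1.
  move=> f g i [S GS Sf] [S' GS' Sg].
  have [SS'|S'S] := Gtot _ _ GS GS'.
    by apply: (GP _ GS').2 => //; exact: SS'.
  by apply: (GP _ GS).2 => //; exact: S'S.
have [[i surj]|nsurj] := pselect (exists i : F,
    set_val i `<=` [set f i | f in S]).
  exists (set_val i); first exact: set_valP.
  move=> B FB; apply: (card_le_trans (subset_card_le surj)).
  apply: (card_le_trans (card_image_le _ _)).
  pose b : F := exist _ B (mem_set FB).
  have SbS : [set f b | f in S] #= S.
    by apply: inj_card_eq => f g /set_mem Sf /set_mem Sg; exact: Sinj.
  rewrite -(card_le_eql SbS).
  by apply: subset_card_le => _ [f Sf <-]; exact: (Sin f Sf b).
have /choice[h hP] : forall i : F, exists x,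
    set_val i x /\ ~ [set f i | f in S] x.
  move=> i; have /existsNP[x /not_implyP xP] :
      ~ (set_val i `<=` [set f i | f in S]).
    by move=> si; apply: nsurj; exists i.
  by exists x.
have Sh : ~ S h.
  by case: F0 => A FA Sh; case: (hP (exist _ A (mem_set FA))) => _; apply; exists h.
exfalso; apply: (Smax (S `|` [set h])).
  by split; [move=> f; left|move=> /(_ h) hS; apply/Sh/hS; right].
split=> [f [Sf|->] i|f g i [Sf|->] [Sg|->] // fg].
- exact: Sin.
- by case: (hP i).
- exact: Sinj fg.
- by case: (hP i) => _ []; exists f.
- by case: (hP i) => _ []; exists g.
Qed.

Implicit Types T X Z : topologicalType.

(* Cardinal invariants are represented by a set realizing the minimum, and
   compared with the library's #<=. *)
Definition is_weight T (B : set (set T)) :=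
  basis B /\ forall B' : set (set T), basis B' -> B #<= B'.

Definition weight T : set (set T) := xget set0 (@is_weight T).
Arguments weight : clear implicits.

Lemma weightP T : is_weight (weight T).
Proof.
have [|B bB Bmin] := @card_min_exists (set T) (@basis T).
  exists open; split=> // x A; rewrite nbhsE => -[U [oU Ux] UA].
  by exists U.
by rewrite /weight; case: xgetP => // /(_ B); apply; split.
Qed.

Definition is_density T (D : set T) :=
  dense D /\ forall D' : set T, dense D' -> D #<= D'.

Definition density T : set T := xget set0 (@is_density T).
Arguments density : clear implicits.

Lemma densityP T : is_density (density T).
Proof.
have [|D dD Dmin] := @card_min_exists T (@dense T).
  by exists setT => O O0 _; rewrite setIT.
by rewrite /density; case: xgetP => // /(_ D); apply; split.
Qed.

(* By uniform_separatorP, completely_regular_space separates points from closed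
   sets by continuous functions into [0, 1]. *)
Definition tychonoff_space T := accessible_space T /\ completely_regular_space T.

Definition baire_space T := forall U : nat -> set T,
  (forall n, open (U n) /\ dense (U n)) -> dense (\bigcap_n U n).

Definition homeomorphic T X := exists (f : T -> X) (g : X -> T),
  [/\ cancel f g, cancel g f, continuous f & continuous g].

Definition metrizable (R : realType) T :=
  exists M : metricType R, homeomorphic T M.

(* The library's completeType is pointed, which would exclude the empty space. *)
Definition complete_metric (R : realType) (M : metricType R) :=
  forall u : nat -> M, cauchy (u @ \oo) -> exists l : M, u @ \oo --> l.

Definition completely_metrizable (R : realType) T :=
  exists2 M : metricType R, complete_metric M & homeomorphic T M.

Definition quasicontinuous Z X (f : Z -> X) :=
  forall z (Oz : set Z) (Ofz : set X), nbhs z Oz -> nbhs (f z) Ofz ->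
  exists U : set Z, [/\ open U, U !=set0, U `<=` Oz & f @` U `<=` Ofz].

Definition piotrowski (C : topologicalType -> Prop) X :=
  forall Z, C Z -> [set: Z] !=set0 ->
  forall f : Z -> X, quasicontinuous f -> exists z, {for z, continuous f}.

Definition baire_metrizable_density_le (R : realType) (V : Type)
    (kappa : set V) Z :=
  [/\ baire_space Z, metrizable R Z & density Z #<= kappa].

(* A strategy s of alpha maps the past moves V_0, ..., V_(n-1) of beta to U_n;
   the past moves of alpha are determined by s and by those of beta.
   beta_legal s V n states that the first n moves of beta along V obey the rules
   against s. *)
Definition beta_legal X (s : seq (set X) -> set X) (V : nat -> set X) n :=
  forall i, (i < n)%N -> [/\ open (V i), V i !=set0 & V i `<=` s (mkseq V i)].

Definition alpha_strategy X (s : seq (set X) -> set X) :=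
  s [::] = setT /\
  forall V n, beta_legal s V n.+1 ->
    [/\ open (s (mkseq V n.+1)), s (mkseq V n.+1) !=set0
      & s (mkseq V n.+1) `<=` V n].

Definition alpha_winning X (s : seq (set X) -> set X) :=
  alpha_strategy s /\
  forall V, (forall n, beta_legal s V n) -> \bigcap_n s (mkseq V n) !=set0.

Definition choquet X := exists s : seq (set X) -> set X, alpha_winning s.

(* Main.v *)
Require Import Defs.
From HB Require Import structures.
From mathcomp Require Import all_boot all_order all_algebra.
From mathcomp Require Import all_classical all_reals all_analysis.

(** The implication from left to right is a direct strategy: if A is dense in X
    and carries a complete metric, alpha answers V_n with an open set U whose
    closure lies in V_n and whose trace on A is contained in a ball of radius
    1/(n+1). Points of A chosen in the successive answers form a Cauchy
    sequence, and its limit belongs to every move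
    ([choquet_of_dense_complete]).

    For the converse, fix a winning strategy s of alpha and a base B of least
    cardinality. The plays against s in which beta only uses members of B are
    the branches of a tree of positions; with the metric of the first
    difference they form a metrizable space. Call a branch convergent when
    alpha's answers along it are a neighborhood base at some point. The
    Piotrowski property makes divergent branches rare, as follows. Suppose
    that a set E of divergent branches is dense below a position t. Choosing
    for every z in E a point f(z) common to all the moves of z gives a
    quasicontinuous map on E, because every basic open set inside alpha's last
    answer is a legal reply of beta, hence contains f(y) for some y in E. For
    the same reason f maps the part of E below a position onto a dense subset
    of alpha's answer there, so at a continuity point z of f the regularity of
    X makes alpha's answers shrink to f(z): z would converge. Hence f has no
    continuity point and, as the density of E is at most |B|, E is not Baire
    ([divergent_not_baire]). Unfolding this failure yields an extension of t
    and countably many dense sets of positions below it such that every branch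
    meeting all of them converges ([exists_residually_convergent_extension]).

    It remains to prune the tree: below every node keep a maximal family of
    extensions with pairwise disjoint answers, taken in the next of the
    countably many dense sets. Each level then covers a dense open subset of
    X, and X is Baire by [choquet_baire], so the intersection of the levels is
    dense. Each of its points determines one branch and is its limit, which
    identifies the intersection with the space of branches of the pruned tree,
    a complete metric space ([dense_completely_metrizable_of_tree]).

    The bound on the density of E uses that an infinite B has as many finite
    sequences as elements ([card_seq_infinite]). A finite base makes X
    discrete, and X itself is then completely metrizable. *)

Set Implicit Arguments.
Unset Strict Implicit.
Unset Printing Implicit Defensive.

Local Open Scope classical_set_scope.

(** * The metric of the first difference *)

Section ultrametric.
Context (R : realType) (T : choiceType) (N : Type) (p : nat -> T -> N).
Hypothesis p_inj : forall x y, (forall n, p n x = p n y) -> x = y.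
Import Order.TTheory GRing.Theory Num.Theory.
Local Open Scope ring_scope.

Definition first_diff_dist (x y : T) : R :=
  if pselect (exists n, `[< p n x <> p n y >]) is left H
  then (ex_minn H).+1%:R^-1 else 0.

Lemma first_diff_distP x y :
  x = y /\ first_diff_dist x y = 0 \/
  exists m, [/\ p m x <> p m y, (forall i, (i < m)%N -> p i x = p i y) &
    first_diff_dist x y = m.+1%:R^-1].
Proof.
rewrite /first_diff_dist; case: pselect => [H|H]; last first.
  left; split=> //; apply: p_inj => n; apply: contrapT => xy.
  by apply: H; exists n; apply/asboolP.
right; case: ex_minnP => m /asboolP xy mmin; exists m; split=> // i im.
apply: contrapT => /asboolP /mmin; by rewrite leqNgt im.
Qed.

Lemma first_diff_dist_ge x y m : p m x <> p m y ->
  m.+1%:R^-1 <= first_diff_dist x y.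
Proof.
move=> xy; case: (first_diff_distP x y) => [[xey _]|[k [_ kmin ->]]].
  by rewrite xey in xy.
rewrite lef_pV2 ?posrE// ler_nat ltnS leqNgt; apply/negP => /kmin; exact: xy.
Qed.

Lemma first_diff_distxx x : first_diff_dist x x = 0.
Proof. by case: (first_diff_distP x x) => [[]//|[m []]]. Qed.

Lemma first_diff_dist_eq0 x y : first_diff_dist x y = 0 -> x = y.
Proof.
case: (first_diff_distP x y) => [[]//|[m [_ _ ->]]] /eqP.
by rewrite invr_eq0 pnatr_eq0.
Qed.

Lemma first_diff_dist_ge0 x y : 0 <= first_diff_dist x y.
Proof. by case: (first_diff_distP x y) => [[_ ->]//|[m [_ _ ->]]]. Qed.

Lemma first_diff_distC x y : first_diff_dist x y = first_diff_dist y x.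
Proof.
have le a b : first_diff_dist a b <= first_diff_dist b a.
  case: (first_diff_distP a b) => [[_ ->]|[m [ab _ ->]]].
    exact: first_diff_dist_ge0.
  by apply: first_diff_dist_ge => /esym.
by apply/eqP; rewrite eq_le !le.
Qed.

Lemma first_diff_dist_triangle y x z :
  first_diff_dist x z <= first_diff_dist x y + first_diff_dist y z.
Proof.
have ge0 := first_diff_dist_ge0.
case: (first_diff_distP x z) => [[_ ->]|[m [xz _ ->]]]; first exact: addr_ge0.
have [xy|xy] := pselect (p m x = p m y); last first.
  by rewrite (le_trans (first_diff_dist_ge xy))// lerDl.
rewrite xy in xz.
by rewrite (le_trans (first_diff_dist_ge xz))// lerDr.
Qed.

(** The carrier records the separation hypothesis and the scalar field, so that
    the metric, which depends on both, can be inferred from the type. *)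
Definition sequence_space of phantom realType R &
  (forall x y, (forall n, p n x = p n y) -> x = y) : Type := T.
Local Notation space := (sequence_space (Phantom realType R) p_inj).
HB.instance Definition _ := Choice.on space.
HB.instance Definition _ := @isMetric.Build R space first_diff_dist
  first_diff_distxx first_diff_dist_eq0 first_diff_distC
  first_diff_dist_triangle.

Lemma nbhs_sequenceP (z : space) (A : set space) :
  nbhs z A <->
  exists n, forall y, (forall i, (i < n)%N -> p i z = p i y) -> A y.
Proof.
rewrite -nbhs_ballE; split=> [[e /= e0 zA]|[n nA]]; last first.
  exists n.+1%:R^-1 => /=; first by rewrite invr_gt0.
  move=> y; rewrite ballEmdist/= => zy; apply: nA => i iltn.
  apply: contrapT => /first_diff_dist_ge; apply/negP; rewrite -ltNge.
  by rewrite (lt_le_trans zy)// lef_pV2 ?posrE// ler_nat ltnS ltnW.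
have [n ne] : exists n : nat, n.+1%:R^-1 < e.
  exists (Num.truncn e^-1).
  rewrite -[ltRHS]invrK ltf_pV2 ?posrE ?invr_gt0//; exact: truncnS_gt.
exists n => y ny; apply: zA; rewrite ballEmdist/=.
have [[_ zy]|[m [zy _ zym]]] := first_diff_distP z y.
  by rewrite /mdist/= zy.
rewrite /mdist/= zym (le_lt_trans _ ne)// lef_pV2 ?posrE// ler_nat ltnS leqNgt.
by apply/negP => /ny.
Qed.

(** Every coordinate is eventually constant along a Cauchy sequence, so that
    completeness only asks for a point realizing the limit coordinates. *)
Lemma sequence_space_complete :
  (forall b : nat -> N,
    (forall n, exists y, forall i, (i < n)%N -> p i y = b i) ->
    exists y, forall n, p n y = b n) ->
  complete_metric space.
Proof.
move=> p_closed u u_cauchy.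
have stable n : exists x, \forall k \near \oo, p n (u k) = p n x.
  have n0 : 0 < n.+1%:R^-1 :> R by rewrite invr_gt0.
  have [x xu] := (cauchyP _).1 u_cauchy _ n0.
  exists x; have {}xu : \forall k \near \oo, ball x n.+1%:R^-1 (u k) := xu.
  apply: filterS xu => k; rewrite ballEmdist/= => xk.
  apply: contrapT => /nesym /first_diff_dist_ge; apply/negP; rewrite -ltNge.
  exact: xk.
have /choice[x xP] := stable.
have [|y yx] := p_closed (fun n => p n (x n)).
  move=> n; have : \forall k \near \oo, forall i, (i < n)%N ->
      p i (u k) = p i (x i).
    elim: n => [|n IH]; first by near=> k.
    near=> k => i; rewrite ltnS leq_eqVlt => /predU1P[->|].
      by near: k; exact: xP.
    by move: i; near: k.
  by move=> /filter_ex[k uk]; exists (u k).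
exists y => A /nbhs_sequenceP[n nA].
have : \forall k \near \oo, forall i, (i < n)%N -> p i y = p i (u k).
  elim: n {nA} => [|n IH]; first by near=> k.
  near=> k => i; rewrite ltnS leq_eqVlt => /predU1P[->|].
    by rewrite yx; apply/esym; near: k; exact: xP.
  by move: i; near: k.
by apply: filterS => k; exact: nA.
Unshelve. all: by end_near. Qed.

End ultrametric.

(** * Finite sequences over an infinite set *)

Section card_seq.
Local Open Scope card_scope.

HB.instance Definition _ (T : choiceType) := isPointed.Build (seq T) [::].

Lemma card_le_total (T : Type) (A B : set T) : A #<= B \/ B #<= A.
Proof.
have [|C [->|->] Cmin] := @card_min_exists T [set A; B].
- by exists A; left.
- by left; apply: Cmin; right.
- by right; apply: Cmin; left.
Qed.

Lemma card_le_inj (T : Type) (U : pointedType) (A : set T) (B : set U) :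
  A #<= B <-> exists2 f : T -> U, set_fun A B f & set_inj A f.
Proof. by rewrite -injfunPex; split=> /pcard_leP. Qed.

Definition seq_over (T : eqType) (A : set T) : set (seq T) :=
  [set s | forall x, x \in s -> A x].

Lemma seq_over_cons (T : eqType) (A : set T) x s :
  seq_over A (x :: s) <-> A x /\ seq_over A s.
Proof.
split=> [As|[Ax As] y]; last by rewrite inE => /predU1P[->|/As].
by split=> [|y ys]; apply: As; rewrite inE ?eqxx ?ys ?orbT.
Qed.

Lemma seq_over_card_le (T U : pointedType) (A : set T) (B : set U) :
  A #<= B -> seq_over A #<= seq_over B.
Proof.
move=> /card_le_inj[f fAB finj]; apply/card_le_inj; exists (map f).
  by move=> s As _ /mapP[x xs ->]; apply/fAB/As.
move=> s t; rewrite !inE.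
elim: s t => [|x s IH] [|y t]//= /seq_over_cons[Ax As] /seq_over_cons[Ay At].
by case=> xy st; rewrite (IH t)//; congr cons; apply: finj; rewrite ?inE.
Qed.

Let nonempty_over (T : eqType) (A : set T) :=
  [set s | s <> [::] /\ seq_over A s].

Lemma card_seq_over_nonempty (T : pointedType) (A : set T) :
  A !=set0 -> seq_over A #<= nonempty_over A.
Proof.
move=> [x Ax]; apply/card_le_inj; exists (cons x).
  by move=> s As; split=> //; apply/seq_over_cons.
by move=> s t _ _ [].
Qed.

(** Elements of S are coded by one-letter words over S and those of Y by
    two-letter words, so the union embeds into S and then so do its words. *)
Lemma card_seq_over_setU (T : pointedType) (S Y : set T) : S !=set0 ->
  nonempty_over S #<= S -> Y #<= S -> seq_over (S `|` Y) #<= S.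
Proof.
move=> S0 nS /card_le_inj[h hYS hinj].
suff SY : S `|` Y #<= S.
  apply: card_le_trans nS.
  exact: card_le_trans (seq_over_card_le SY) (card_seq_over_nonempty S0).
apply: card_le_trans nS.
apply/card_le_inj; exists (fun x => if x \in S then [:: x] else [:: h x; h x]).
  move=> x SYx; have [/set_mem Sx|/negP xS] := boolP (x \in S).
    by split=> //; apply/seq_over_cons.
  case: SYx => [/mem_set//|/hYS ?].
  by split=> //; apply/seq_over_cons; split=> //; apply/seq_over_cons.
move=> x y /set_mem SYx /set_mem SYy.
have [xS|xS] := boolP (x \in S); have [yS|yS] := boolP (y \in S) => //.
  by case.
case=> hxy _; apply: hinj => //; rewrite inE.
  by case: SYx => // /mem_set; rewrite (negbTE xS).
by case: SYy => // /mem_set; rewrite (negbTE yS).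
Qed.

(** A direct form of the theorem |A x A| = |A|. Injections from the nonempty
    words over a subset S of A into S are ordered by extension; a maximal one
    has |A \ S| <= |S|, since otherwise a copy of S in A \ S could absorb the
    words using new letters. The claim then follows from
    [card_seq_over_setU]. *)
Lemma card_seq_infinite (T : pointedType) (A : set T) :
  infinite_set A -> seq_over A #<= A.
Proof.
move=> Ainf.
(* An injection is represented by its graph, and S is the set of letters on
   which the graph is defined. *)
pose supp (G : set (seq T * T)) := [set x | exists y, G ([:: x], y)].
pose P := [set G | [/\ supp G `<=` A,
  (forall s y, G (s, y) -> nonempty_over (supp G) s /\ supp G y),
  (forall s, nonempty_over (supp G) s -> exists y, G (s, y)) &
  (forall s t y, G (s, y) -> G (t, y) -> s = t)]].
have [G [[GA Gin Gtot Ginj] Gmax]] :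
    exists G, P G /\ forall G', G `<` G' -> ~ P G'.
  apply: Zorn_bigcup => F FP Ftot.
  have suppF G : F G -> supp G `<=` supp (\bigcup_(X in F) X).
    by move=> FG x [y Gxy]; exists y, G.
  split.
  - by move=> x [y [G FG Gxy]]; case: (FP _ FG) => + _ _ _; apply; exists y.
  - move=> s y [G FG Gsy]; have [_ /(_ _ _ Gsy)[[s0 sG] yG] _ _] := FP _ FG.
    by split; [split=> // x /sG|]; exact: (suppF _ FG).
  - move=> s [s0 sF].
    have [G FG sG] : exists2 G, F G & seq_over (supp G) s.
      have [G0 FG0] : exists G, F G.
        case: s s0 sF => // x s _ /seq_over_cons[[y [G FG _]] _].
        by exists G.
      elim: s {s0} sF => [|x s IH]; first by exists G0.
        move=> /seq_over_cons[[y [G FG Gxy]] /IH[H FH Hs]].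
        have [GH|HG] := Ftot _ _ FG FH.
          exists H => //; apply/seq_over_cons; split=> //.
          by exists y; exact: GH.
        exists G => //; apply/seq_over_cons; split; first by exists y.
        by move=> z /Hs[w Hzw]; exists w; exact: HG.
    by have [_ _ /(_ s)[//|y Gsy] _] := FP _ FG; exists y, G.
  - move=> s t y [G FG Gsy] [H FH Hty].
    have [GH|HG] := Ftot _ _ FG FH.
      by have [_ _ _ Hinj] := FP _ FH; apply: Hinj (GH _ Gsy) Hty.
    by have [_ _ _ Ginj] := FP _ FG; apply: Ginj Gsy (HG _ Hty).
pose S := supp G.
have nS : nonempty_over S #<= S.
  have /choice[g gP] : forall s, exists y, nonempty_over S s -> G (s, y).
    move=> s; have [/Gtot[y Gsy]|] := pselect (nonempty_over S s).
      by exists y.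
    by exists point.
  apply/card_le_inj; exists g; first by move=> s /gP /Gin[].
  move=> s t /set_mem/gP Gs /set_mem/gP Gt st; apply: Ginj Gs _.
  by rewrite st.
have [AS|SA] := card_le_total (A `\` S) S.
  have S0 : S !=set0.
    apply/set0P/eqP => S0; apply: Ainf.
    by move: AS; rewrite S0 setD0 card_le0 => /eqP ->.
  rewrite -[A in seq_over A](setDUK GA).
  exact: card_le_trans (card_seq_over_setU S0 nS AS) (subset_card_le GA).
(* The new letters: a countable set if S is empty, else a copy of S. *)
have [Y [YAS Y0 SY]] : exists Y, [/\ Y `<=` A `\` S, Y !=set0
    & seq_over (S `|` Y) #<= Y].
  have [S0|/set0P S0] := eqVneq S set0.
    have /infiniteP/card_le_inj[f fA finj] := Ainf.
    exists (range f); split.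
        by move=> _ [n _ <-]; rewrite S0 setD0; exact: fA.
      by exists (f 0%N), 0%N.
    have natY : range f #= [set: nat] by exact: inj_card_eq.
    rewrite S0 set0U; apply: (@card_le_trans _ _ _ [set: nat]); last first.
      by rewrite (card_le_eqr natY).
    apply: (@card_le_trans _ _ _ (seq_over [set: nat])).
      by apply: seq_over_card_le; rewrite (card_le_eql natY).
    apply/card_le_inj; exists pickle => // s t _ _.
    exact: (pcan_inj pickleK).
  have /card_le_inj[h hSA hinj] := SA.
  have hSS : h @` S #= S by exact: inj_card_eq.
  exists (h @` S); split; first by move=> _ [x Sx <-]; exact: hSA.
    by case: S0 => x Sx; exists (h x), x.
  rewrite (card_le_eqr hSS); apply: card_seq_over_setU => //.
  by rewrite (card_le_eql hSS).
exfalso.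
have /card_le_inj[g gY ginj] := SY.
have SYn x : S x -> Y x -> False by move=> Sx /YAS[].
pose G' := G `|` [set u | [/\ u.2 = g u.1, nonempty_over (S `|` Y) u.1
  & ~ nonempty_over S u.1]].
have suppG' : supp G' = S `|` Y.
  apply/seteqP; split=> [x [y [Gxy|[_ /= [_ /seq_over_cons[]] //]]]|x].
    by left; exists y.
  move=> [[y Gxy]|Yx]; first by exists y; left.
  exists (g [:: x]); right; split=> //=.
    by split=> //; apply/seq_over_cons; split=> //; right.
  by move=> [_ /seq_over_cons[Sx _]]; exact: SYn Sx Yx.
apply: (Gmax G').
  split=> [|G'G]; first by left.
  have [x Yx] := Y0.
  have : supp G' x by rewrite suppG'; right.
  by move=> [y /G'G Gxy]; apply: SYn Yx; exists y.
have SsubSY s : nonempty_over S s -> nonempty_over (S `|` Y) s.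
  by move=> [s0 Ss]; split=> // x /Ss; left.
split; rewrite ?suppG'.
- by move=> x [/GA//|/YAS[]].
- move=> s y [/Gin[/SsubSY ? ?]|/= [-> sSY _]]; first by split=> //; left.
  by split=> //; right; apply: gY; case: sSY.
- move=> s sSY; have [/Gtot[y Gsy]|nsS] := pselect (nonempty_over S s).
    by exists y; left.
  by exists (g s); right.
- move=> s t y [Gs|[/= ys [_ sSY] _]] [Gt|[/= yt [_ tSY] _]].
  + exact: Ginj Gs Gt.
  + by have [_ Sy] := Gin _ _ Gs; case: (SYn y) => //; rewrite yt; exact: gY.
  + by have [_ Sy] := Gin _ _ Gt; case: (SYn y) => //; rewrite ys; exact: gY.
  + by apply: ginj; rewrite ?inE// -ys.
Qed.
End card_seq.

(** * Dense completely metrizable subspaces from trees of open sets *)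

Lemma nbhs_set_typeP (X : topologicalType) (A : set X) (y : set_type A)
    (B : set (set_type A)) :
  nbhs y B <-> exists2 W, nbhs (set_val y) W & set_val @^-1` W `<=` B.
Proof.
split=> [ | [W yW WB]]; last first.
  by apply: filterS WB _; exact: (@initial_continuous _ _ set_val).
rewrite nbhsE => -[U [[W oW <-] Wy] WB]; exists W => //.
by exists W => //; split.
Qed.

Lemma maximal_disjoint_subfamily (I T : Type) (U : I -> set T) (D : set I) :
  exists C, [/\ C `<=` D,
    forall c d x, C c -> C d -> U c x -> U d x -> c = d &
    forall d, D d -> U d !=set0 -> exists2 c, C c & U d `&` U c !=set0].
Proof.
pose P := [set C | C `<=` D /\
  forall c d x, C c -> C d -> U c x -> U d x -> c = d].
have [C [[CD Cdisj] Cmax]] : exists C, P C /\ forall C', C `<` C' -> ~ P C'.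
  apply: Zorn_bigcup => F FP Ftot.
  split=> [c [C FC]|c d x [C FC Cc] [D' FD Dd]].
    exact: (FP _ FC).1.
  have [CD|DC] := Ftot _ _ FC FD.
    by apply: (FP _ FD).2 => //; exact: CD.
  by apply: (FP _ FC).2 => //; exact: DC.
exists C; split=> // d Dd [x dx]; apply: contrapT => noc.
have Cdis c : C c -> forall y, U d y -> U c y -> False.
  by move=> Cc y dy cy; apply: noc; exists c => //; exists y.
apply: (Cmax (C `|` [set d])).
  split=> [c|]; first by left.
  by move=> /(_ d (or_intror erefl)) Cd; exact: (Cdis d Cd x).
split=> [c [/CD//|->//]|c c' y [Cc|->] [Cc'|->] // cy c'y].
- exact: Cdisj cy c'y.
- by case: (Cdis c Cc y).
- by case: (Cdis c' Cc' y).
Qed.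

(** A tree is given by its root and its child relation on nodes, each node
    carrying an open set. The hypotheses say that the nodes form a pi-base
    below each of them and that every branch shrinks to a point. *)
Section disjoint_tree.
Context (R : realType) (X : topologicalType) (N : Type).
Context (ok : set N) (U : N -> set X) (child : N -> N -> Prop) (root : N).
Hypothesis X_accessible : accessible_space X.
Hypothesis X_baire : baire_space X.
Hypothesis root_ok : ok root.
Hypothesis U_root : U root = setT.
Hypothesis child_ok : forall n c, ok n -> child n c ->
  [/\ ok c, open (U c) & U c `<=` U n].
Hypothesis child_dense : forall n W, ok n -> open W -> W !=set0 ->
  W `<=` U n -> exists c, [/\ child n c, U c !=set0 & U c `<=` W].
Hypothesis branch_cvg : forall b : nat -> N, b 0 = root ->
  (forall n, child (b n) (b n.+1)) ->
  exists x, (forall n, U (b n) x) /\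
    forall O, nbhs x O -> exists n, U (b n) `<=` O.

(** Keeping a maximal disjoint family of children below each node leaves a tree
    in which a point lies in at most one node of each level. The points lying
    in a node of every level are coded by these nodes, and since branches
    shrink to points this coding is a homeomorphism onto all the branches. *)
Lemma dense_completely_metrizable_of_tree :
  exists2 A : set X, dense A & completely_metrizable R (set_type A).
Proof.
have /choice[C CP] := fun n => maximal_disjoint_subfamily U (child n).
pose fix level n : set N := if n is n'.+1 then
  [set c | exists2 m, level n' m & C m c] else [set root].
have level_ok n m : level n m -> ok m /\ open (U m).
  elim: n m => [|n IH] m /=; first move=> ->.
    by rewrite U_root; split=> //; exact: openT.
  move=> [k /IH[kok _] Ckm]; have [CE _ _] := CP k.
  by have [] := child_ok kok (CE _ Ckm).
have level_sub m c n : level n m -> C m c -> U c `<=` U m.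
  move=> /level_ok[mok _] Cmc; have [CE _ _] := CP m.
  by have [] := child_ok mok (CE _ Cmc).
have level_uniq n m m' x : level n m -> level n m' -> U m x -> U m' x -> m = m'.
  elim: n m m' => [|n IH] m m' /=; first by move=> -> ->.
  move=> [k nk kc] [k' nk' kc'] mx m'x.
  have kk' : k = k' by apply: IH => //;
    [exact: level_sub nk kc _ mx|exact: level_sub nk' kc' _ m'x].
  by rewrite -{k' nk'}kk' in kc'; have [_ + _] := CP k; apply; eauto.
pose V n := \bigcup_(m in level n) U m.
pose Y := \bigcap_n V n.
have V_open n : open (V n).
  by apply: bigcup_open => m /level_ok[].
have V_dense n : dense (V n).
  elim: n => [|n IH] W W0 oW.
    by case: W0 => x Wx; exists x; split=> //; exists root; rewrite ?U_root.
  have [x [Wx [m nm mx]]] := IH _ W0 oW.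
  have [mok om] := level_ok _ _ nm.
  have [| |c [mc [y cy] cWm]] := child_dense mok (openI oW om).
  - by exists x.
  - by apply: subIsetr.
  have [_ _ /(_ _ mc)[|d Cd [z [cz dz]]]] := CP m; first by exists y.
  by exists z; split; [exact: (cWm _ cz).1|exists d => //; exists m].
have Y_dense : dense Y by apply: X_baire => n; split.
have /choice[node_at nodeP] : forall u : set_type Y * nat,
    exists m, level u.2 m /\ U m (set_val u.1).
  by move=> [y n]; have [m nm my] := set_valP y n I; exists m.
pose p n (y : set_type Y) := node_at (y, n).
have p_level n y : level n (p n y) := (nodeP (y, n)).1.
have p_in n y : U (p n y) (set_val y) := (nodeP (y, n)).2.
have pE n y m : level n m -> U m (set_val y) -> p n y = m.
  by move=> nm my; exact: level_uniq (p_level n y) nm (p_in n y) my.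
have p_C n y : C (p n y) (p n.+1 y).
  have [m nm mC] := p_level n.+1 y.
  by rewrite (pE n y m)//; exact: level_sub nm mC _ (p_in n.+1 y).
have p_cvg y O : nbhs (set_val y) O -> exists n, U (p n y) `<=` O.
  have [| |x [px xbase]] := @branch_cvg (p^~ y).
  - exact: (p_level 0%N y).
  - by move=> n; have [CE _ _] := CP (p n y); apply: CE.
  suff -> : set_val y = x by exact: xbase.
  apply: contrapT => /eqP; rewrite eq_sym => /X_accessible[B [oB xB yB]].
  have [|n pB] := xbase B.
    by apply: open_nbhs_nbhs; split=> //; exact/set_mem.
  by move/set_mem: yB; apply; apply: pB.
have p_inj y z : (forall n, p n y = p n z) -> y = z.
  move=> yz; apply: val_inj => /=; apply: contrapT.
  move=> /eqP /X_accessible[B [oB yB zB]].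
  have [|n pB] := p_cvg y B.
    by apply: open_nbhs_nbhs; split=> //; exact/set_mem.
  by move/set_mem: zB; apply; apply: pB; rewrite yz.
(* A node determines its ancestors, so agreement at one level propagates to
   the lower ones. *)
have p_eq n y z : p n y = p n z -> forall i, (i <= n)%N -> p i y = p i z.
  elim: n => [|n IH] yz i; first by rewrite leqn0 => /eqP ->.
  rewrite leq_eqVlt => /predU1P[->//|]; rewrite ltnS; apply: IH.
  apply: pE; first exact: p_level.
  apply: level_sub (p_level n z) (p_C n z) _ _.
  by rewrite -yz.
exists Y => //.
exists (sequence_space (Phantom realType R) p_inj).
  (* A limit sequence of nodes is again a branch, and the point to which it
     shrinks has these nodes as coordinates. *)
  apply: sequence_space_complete => b bP.
  have b_prefix n : exists y, forall i, (i <= n)%N -> p i y = b i.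
    by have [y yb] := bP n.+1; exists y => i /yb.
  have b_C n : C (b n) (b n.+1).
    by have [y yb] := b_prefix n.+1; rewrite -!yb.
  have b_level n : level n (b n).
    by have [y yb] := b_prefix n; rewrite -yb.
  have [| |x [bx _]] := @branch_cvg b.
  - exact: (b_level 0%N).
  - by move=> n; have [CE _ _] := CP (b n); apply: CE.
  have Yx : Y x by move=> n _; exists (b n).
  exists (exist _ x (mem_set Yx)) => n; exact: pE.
exists id, id; split=> //.
  move=> y B /nbhs_sequenceP[n nB]; apply/nbhs_set_typeP.
  exists (U (p n y)).
    by apply: open_nbhs_nbhs; split=> //; exact: (level_ok _ _ (p_level n y)).2.
  move=> z /= pz; apply: nB => i /ltnW; apply: p_eq.
  by apply/esym/pE.
move=> y B /nbhs_set_typeP[W yW WB]; apply/nbhs_sequenceP.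
have [n nO] := p_cvg _ _ yW; exists n.+1 => z yz; apply: WB => /=; apply: nO.
by rewrite yz.
Qed.

End disjoint_tree.

(** * Positions and branches of the Choquet game *)

Lemma prefix_mkseq (T : eqType) (z : nat -> T) m n :
  (m <= n)%N -> prefix (mkseq z m) (mkseq z n).
Proof.
move=> mn; rewrite prefixE size_mkseq /mkseq -map_take take_iota.
by rewrite (minn_idPl mn).
Qed.

Section strategy.
Context (X : topologicalType) (s : seq (set X) -> set X).
Hypothesis s_strategy : alpha_strategy s.

Lemma strategy_legal V n : beta_legal s V n ->
  [/\ open (s (mkseq V n)), [set: X] !=set0 -> s (mkseq V n) !=set0
    & forall m, (m <= n)%N -> s (mkseq V n) `<=` s (mkseq V m)].
Proof.
have [s0 sS] := s_strategy.
elim: n => [|n IH] VL.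
  rewrite /= s0; split=> [|//|m]; first exact: openT.
  by rewrite leqn0 => /eqP ->; rewrite /= s0.
have [|_ _ IHn] := IH; first by move=> i /ltnW; exact: VL.
have [os s1 sV] := sS _ _ VL; split=> // m.
rewrite leq_eqVlt => /predU1P[->//|].
rewrite ltnS => /IHn; apply: subset_trans; apply: (subset_trans sV).
by have [] := VL n (ltnSn n).
Qed.

Section positions.
Context (B : set (set X)).
Hypothesis B_basis : basis B.

Lemma basis_refine W : open W -> W !=set0 ->
  exists V, [/\ B V, open V, V !=set0 & V `<=` W].
Proof.
move=> oW [x Wx]; have [B_open B_nbhs] := B_basis.
have [|V [BV Vx] VW] := B_nbhs x W; first by apply: open_nbhs_nbhs; split.
by exists V; split=> //; [exact: B_open|exists x].
Qed.

(** A position lists beta's moves so far, all taken in the base B; as alpha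
    follows s, it determines the whole play. *)
Definition position : set (seq (set X)) :=
  [set t | beta_legal s (nth set0 t) (size t) /\ seq_over B t].

Definition branch : set (nat -> set X) :=
  [set z | forall n, beta_legal s z n /\ B (z n)].

Definition through (t : seq (set X)) : set (nat -> set X) :=
  [set z | mkseq z (size t) = t].

Lemma through_mkseq z n : through (mkseq z n) z.
Proof. by rewrite /through/= size_mkseq. Qed.

Lemma through_prefix t t' : prefix t t' -> through t' `<=` through t.
Proof.
move=> /prefixP[r ->] z; rewrite /through/= => zt.
have := prefix_mkseq z (leq_addr (size r) (size t)).
by rewrite -size_cat zt prefixE take_size_cat ?size_mkseq// => /eqP.
Qed.

Lemma through_nth t z i : through t z -> (i < size t)%N -> nth set0 t i = z i.
Proof. by move=> <-; rewrite size_mkseq => it; rewrite nth_mkseq. Qed.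

Lemma beta_legal_eq V V' n : (forall i, (i < n)%N -> V i = V' i) ->
  beta_legal s V n -> beta_legal s V' n.
Proof.
move=> VV' VL i iltn; rewrite -VV'//.
suff -> : mkseq V' i = mkseq V i by exact: VL.
apply/eq_in_map => j; rewrite mem_iota /= add0n => ji.
by rewrite VV'// (ltn_trans ji).
Qed.

Lemma branch_position z n : branch z -> position (mkseq z n).
Proof.
move=> zb; split; last by move=> _ /mapP[i _ ->]; have [] := zb i.
rewrite size_mkseq; have [+ _] := zb n; apply: beta_legal_eq => i iltn.
by rewrite nth_mkseq.
Qed.

Lemma position_legal t : position t ->
  [/\ open (s t), [set: X] !=set0 -> s t !=set0
    & forall t', prefix t' t -> s t `<=` s t'].
Proof.
move=> [/strategy_legal]; rewrite mkseq_nth => -[ot t0 tm] _; split=> // t' t't.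
have := tm _ (size_prefix t't).
suff -> : mkseq (nth set0 t) (size t') = t' by [].
have /through_prefix := t't; apply.
by rewrite /through/= mkseq_nth.
Qed.

Lemma position_rcons t V : position t -> B V -> open V -> V !=set0 ->
  V `<=` s t -> position (rcons t V) /\ s (rcons t V) `<=` V.
Proof.
move=> [tL tB] BV oV V0 Vt.
have pt : position (rcons t V).
  split; last by move=> W; rewrite mem_rcons inE => /predU1P[->//|/tB].
  move=> i; rewrite size_rcons ltnS leq_eqVlt => /predU1P[->|it].
    rewrite nth_rcons ltnn eqxx; split=> //.
    suff -> : mkseq (nth set0 (rcons t V)) (size t) = t by [].
    have /through_prefix := prefix_rcons t V; apply.
    by rewrite /through/= mkseq_nth.
  have := it; move: i {it}; apply: (@beta_legal_eq (nth set0 t)) => // i it.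
  by rewrite nth_rcons it.
split=> //; have [_ sS] := s_strategy; have [tVL _] := pt.
rewrite size_rcons in tVL.
have [_ _] := sS _ _ tVL.
by rewrite -(size_rcons t V) mkseq_nth nth_rcons ltnn eqxx.
Qed.

Lemma position_refine t W : position t -> open W -> W !=set0 ->
  W `<=` s t -> exists t', [/\ position t', prefix t t', (size t < size t')%N
    & s t' `<=` W].
Proof.
move=> tp oW W0 Wt; have [V [BV oV V0 VW]] := basis_refine oW W0.
have [tVp sV] := position_rcons tp BV oV V0 (subset_trans VW Wt).
exists (rcons t V); split=> //; first exact: prefix_rcons.
  by rewrite size_rcons.
exact: subset_trans sV VW.
Qed.

End positions.
End strategy.

(** Against the winning strategy, beta intersects alpha's answer with the n-th
    dense open set; the point that alpha wins lies in all of them. *)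
Lemma choquet_baire (X : topologicalType) (s : seq (set X) -> set X) :
  alpha_winning s -> baire_space X.
Proof.
move=> [s_strategy win] U Uod W W0 oW; have [s0 sS] := s_strategy.
pose fix t n := if n is n'.+1
  then rcons (t n') (W `&` U n' `&` s (t n')) else [::].
pose V n := W `&` U n `&` s (t n).
have tE n : mkseq V n = t n.
  by elim: n => // n IH; rewrite mkseqS IH.
have VL n : beta_legal s V n.
  elim: n => // n IH i; rewrite ltnS leq_eqVlt => /predU1P[->|]; last exact: IH.
  have [oU dU] := Uod n.
  have osn : open (s (t n)).
    by rewrite -tE; have [] := strategy_legal s_strategy IH.
  split; first by apply: openI => //; apply: openI.
    have Wsn : W `&` s (t n) !=set0.
      case: (n) IH => [|m] IH; first by rewrite /= s0 setIT.
      have [_ [x sx] sV] := sS _ _ IH; exists x; rewrite -tE; split=> //.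
      by have [[]] := sV _ sx.
    have [x [[Wx sx] Ux]] := dU _ Wsn (openI oW osn).
    by exists x.
  by rewrite tE; exact: subIsetr.
have [x xs] := win V VL.
have xV n : V n x.
  have [_ _ sV] := sS V n (VL n.+1); exact: sV (xs n.+1 I).
by exists x; split; [have [[]] := xV 0%N|move=> n _; have [[]] := xV n].
Qed.

(** * Divergent branches *)

Section piotrowski_tree.
Context (R : realType) (X : topologicalType) (s : seq (set X) -> set X).
Context (B : set (set X)).
Hypothesis s_winning : alpha_winning s.
Hypothesis B_basis : basis B.
Hypothesis B_infinite : infinite_set B.
Hypothesis X_regular : regular_space X.
Hypothesis X_piotrowski : piotrowski (baire_metrizable_density_le R B) X.

Let s_strategy : alpha_strategy s. Proof. by case: s_winning. Qed.
Local Notation position := (position s B).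
Local Notation branch := (branch s B).

Definition convergent : set (nat -> set X) :=
  [set z | exists x, (forall n, s (mkseq z n) x) /\
    forall W, nbhs x W -> exists n, s (mkseq z n) `<=` W].

Definition dense_below (t : seq (set X)) (G : nat -> set (seq (set X))) :=
  forall n t', position t' -> prefix t t' ->
  exists t'', [/\ position t'', prefix t' t'' & G n t''].

(** E is a set of divergent branches through t that is dense below t, viewed
    as a subspace [S] of the space of branches. *)
Section divergent_set.
Context (t : seq (set X)) (E : set (nat -> set X)).
Hypothesis E_branch : E `<=` branch.
Hypothesis E_divergent : forall z, E z -> ~ convergent z.
Hypothesis E_through : E `<=` through t.
Hypothesis E_dense : forall t', position t' -> prefix t t' ->
  E `&` through t' !=set0.
Hypothesis t_position : position t.

Let p n (z : set_type E) : set X := set_val z n.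

Let p_inj y z : (forall n, p n y = p n z) -> y = z.
Proof. by move=> yz; apply: val_inj; apply/funext => n; exact: yz. Qed.

Local Notation S := (sequence_space (Phantom realType R) p_inj).

Let through_agree (y z : S) n : (forall i, (i < n)%N -> p i z = p i y) <->
  through (mkseq (set_val z) n) (set_val y).
Proof.
rewrite /through/= size_mkseq; split=> [zy|yz i iltn].
  by apply/eq_in_map => i; rewrite mem_iota add0n /= => iltn; exact/esym/zy.
have := congr1 (nth set0 ^~ i) yz; rewrite !nth_mkseq// => /esym; exact.
Qed.

Let S_branch (z : S) : branch (set_val z).
Proof. by apply: E_branch; exact: set_valP. Qed.

Let S_prefix (z : S) n : (size t <= n)%N -> prefix t (mkseq (set_val z) n).
Proof.
have /E_through <- := set_valP z.
by rewrite size_mkseq; exact: prefix_mkseq.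
Qed.

(** Where density of E enters: any open set meeting alpha's answer contains a
    legal basic reply of beta, and some branch of E continues that way. *)
Let S_refine (z : S) n W : (size t <= n)%N -> open W ->
  s (mkseq (set_val z) n) `&` W !=set0 ->
  exists t', [/\ exists y : S, through t' (set_val y),
    prefix (mkseq (set_val z) n) t' & s t' `<=` W].
Proof.
move=> tn oW zW.
have zp := branch_position n (S_branch z).
have [oz _ _] := position_legal s_strategy zp.
have [|t' [t'p zt' _ t'W]] :=
    position_refine s_strategy B_basis zp (openI oz oW) zW.
  exact: subIsetl.
exists t'; split=> //.
- have [|y [Ey yt']] := E_dense t'p.
    exact: prefix_trans (S_prefix _ tn) zt'.
  by exists (exist _ y (mem_set Ey)).
- by apply: subset_trans t'W _; exact: subIsetr.
Qed.

Let through_open t' : open [set y : S | through t' (set_val y)].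
Proof.
rewrite openE => y yt'; apply/nbhs_sequenceP; exists (size t') => z.
by move=> /through_agree; rewrite (yt' : mkseq _ _ = _).
Qed.

(** Picking a branch of E through each position that E meets gives a dense set
    indexed by words over B. *)
Lemma divergent_density : (density S #<= B)%card.
Proof.
have [y0 [Ey0 _]] := E_dense t_position (prefix_refl t).
have /choice[h hP] : forall t', exists y : S,
    (exists y' : S, through t' (set_val y')) -> through t' (set_val y).
  move=> t'; have [[y yt']|] := pselect (exists y : S, through t' (set_val y)).
    by exists y.
  by exists (exist _ y0 (mem_set Ey0)).
have dh : dense (h @` seq_over B).
  move=> W [z Wz]; rewrite openE => /(_ z Wz) /nbhs_sequenceP[n nW].
  exists (h (mkseq (set_val z) n)); split.
    apply: nW; apply/through_agree; apply: hP; exists z.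
    exact: through_mkseq.
  exists (mkseq (set_val z) n) => //.
  by have [] := branch_position n (S_branch z).
have [_ dmin] := densityP S.
apply: (card_le_trans (dmin _ dh)); apply: card_le_trans (card_image_le _ _) _.
exact: card_seq_infinite.
Qed.

(** Otherwise a selection f of points won by alpha would have a continuity
    point z. Both its quasicontinuity and the convergence of z rest on
    [S_refine]: the former directly, the latter because it makes the values of
    f below a position dense in alpha's answer, so that this answer lies in the
    closure of any set containing those values. *)
Lemma divergent_not_baire : ~ baire_space S.
Proof.
move=> S_baire.
have [y0 [Ey0 _]] := E_dense t_position (prefix_refl t).
have /choice[f fP] : forall z : S, exists x, forall n,
    s (mkseq (set_val z) n) x.
  move=> z; have [_ win] := s_winning.
  have [|x xs] := win (set_val z); first by move=> n; have [] := S_branch z n.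
  by exists x => n; exact: xs.
have f_through (y : S) t' : through t' (set_val y) -> s t' (f y).
  by move=> <-.
have fqc : quasicontinuous (f : S -> X).
  move=> z Oz Of /nbhs_sequenceP[n nOz].
  rewrite nbhsE => -[W [oW Wf] WOf].
  have tm := leq_maxl (size t) n; set m := maxn _ _ in tm.
  have [|t' [[y yt'] zt' t'W]] := S_refine tm oW (z := z).
    by exists (f z); split=> //; exact: fP.
  have agree (y' : S) : through t' (set_val y') ->
      forall i, (i < n)%N -> p i z = p i y'.
    move=> y't' i iltn; move: i iltn.
    move: (through_prefix zt' y't') => /through_agree zy i iltn.
    by apply: zy; rewrite (leq_trans iltn)// leq_maxr.
  (* All branches of E through t' are mapped into W. *)
  exists [set y' : S | through t' (set_val y')]; split.
  - exact: through_open.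
  - by exists y.
  - by move=> y' /agree y'z; exact: nOz.
  - by move=> _ [y' y't' <-]; apply/WOf/t'W/f_through.
have [||z fz] := X_piotrowski _ _ fqc.
- split=> //; last exact: divergent_density.
  by exists S, id, id; split=> //; move=> ?; exact: cvg_id.
- by exists (exist _ y0 (mem_set Ey0)).
apply: (E_divergent (set_valP z)); exists (f z).
split=> [|W fzW]; first exact: fP.
have [V fzV VW] := X_regular fzW.
have /nbhs_sequenceP[n nV] := fz _ fzV.
have tm := leq_maxl (size t) n; set m := maxn _ _ in tm.
exists m => x xm; apply: VW => A xA.
rewrite nbhsE in xA; have [A' [oA' A'x] A'A] := xA.
have [|t' [[y yt'] zt' t'W]] := S_refine tm oA' (z := z).
  by exists x.
exists (f y); split; last by apply/A'A/t'W/f_through.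
apply: nV => i iltn; move: i iltn.
move: (through_prefix zt' yt') => /through_agree zy i iltn.
by apply: zy; rewrite (leq_trans iltn)// leq_maxr.
Qed.

(** A failure of the Baire property is located at an open set, which may be
    taken to be the branches below a position. *)
Lemma divergent_meager_below : exists t' G,
  [/\ position t', prefix t t', dense_below t' G &
    forall z, E z -> through t' z -> ~ forall n, exists m, G n (mkseq z m)].
Proof.
have := divergent_not_baire.
move=> /existsNP[U /not_implyP[Uod /existsNP[W]]].
move=> /not_implyP[[z Wz] /not_implyP[oW WU]].
move: oW; rewrite openE => /(_ z Wz) /nbhs_sequenceP[n0 nW].
have tm := leq_maxl (size t) n0; set m := maxn _ _ in tm.
(* Positions below which all of E lies in the n-th open set. *)
pose G n t' := forall y : S, through t' (set_val y) -> U n y.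
exists (mkseq (set_val z) m), G; split.
- exact: branch_position (S_branch z).
- exact: S_prefix.
- move=> n t' t'p zt'.
  have [|y [Ey yt']] := E_dense t'p.
    exact: prefix_trans (S_prefix _ tm) zt'.
  have [oU dU] := Uod n.
  have [|y1 [y1t' Uy1]] := dU _ _ (@through_open t').
    by exists (exist _ y (mem_set Ey)).
  move: oU; rewrite openE => /(_ y1 Uy1) /nbhs_sequenceP[k kU].
  exists (mkseq (set_val y1) (maxn (size t') k)); split.
  + exact: branch_position (S_branch y1).
  + by rewrite -{1}(y1t' : mkseq _ _ = _); apply: prefix_mkseq; exact: leq_maxl.
  + move=> y2 /through_agree y2y1; apply: kU => i iltk; apply: y2y1.
    by rewrite (leq_trans iltk)// leq_maxr.
- move=> z' Ez' z't GU; apply: WU; exists (exist _ z' (mem_set Ez')); split.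
    apply: nW => i iltn; move: i iltn.
    have /through_agree zy : through (mkseq (set_val z) m)
      (set_val (exist _ z' (mem_set Ez') : S)) by [].
    by move=> i iltn; apply: zy; rewrite (leq_trans iltn)// leq_maxr.
  move=> n _; have [k kG] := GU n; apply: kG.
  exact: through_mkseq.
Qed.

End divergent_set.

(** Below a suitable extension of t the convergent branches contain those that
    meet countably many dense sets of positions. If the divergent branches are
    not dense below t, some extension has none at all. *)
Lemma exists_residually_convergent_extension t : position t -> exists t' G,
  [/\ position t', prefix t t', dense_below t' G &
   forall z, branch z -> through t' z ->
     (forall n, exists m, G n (mkseq z m)) -> convergent z].
Proof.
move=> tp.
pose E := [set z | [/\ branch z, through t z & ~ convergent z]].
have [E_dense|] := pselect (forall t', position t' -> prefix t t' ->
    E `&` through t' !=set0); last first.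
  move=> /existsNP[t' /not_implyP[t'p /not_implyP[tt' t'E]]].
  exists t', (fun=> setT); split=> //.
    by move=> n t'' t''p _; exists t''; split=> //; exact: prefix_refl.
  move=> z zb zt' _; apply: contrapT => zd; apply: t'E.
  by exists z; split=> //; split=> //; exact: through_prefix tt' _ zt'.
have Eb : E `<=` branch by move=> z [].
have Et : E `<=` through t by move=> z [].
have Ed z : E z -> ~ convergent z by case.
have [t' [G [t'p tt' dG GE]]] := divergent_meager_below Eb Ed Et E_dense tp.
exists t', G; split=> // z zb zt' zG; apply: contrapT => zd.
by apply: (GE z) => //; split=> //; exact: through_prefix tt' _ zt'.
Qed.

End piotrowski_tree.

(** * From winning strategies to complete metrics *)

Section choquet_to_metrizable.
Context (R : realType) (X : topologicalType) (s : seq (set X) -> set X).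
Context (B : set (set X)).
Hypothesis s_winning : alpha_winning s.
Hypothesis B_basis : basis B.
Hypothesis X_accessible : accessible_space X.

Let s_strategy : alpha_strategy s. Proof. by case: s_winning. Qed.

Let X_baire : baire_space X. Proof. exact: choquet_baire s_winning. Qed.

(** In an accessible space with a finite base each point is the intersection of
    its finitely many basic neighborhoods, hence open; the singletons form a
    tree of height one, prolonged by constant branches. *)
Lemma finite_basis_completely_metrizable : finite_set B ->
  exists2 A : set X, dense A & completely_metrizable R (set_type A).
Proof.
move=> B_finite; have [B_open B_nbhs] := B_basis.
have point_open (x : X) : open [set x].
  suff -> : [set x] = \bigcap_(V in B `&` [set V | V x]) V.
    rewrite -closedC setC_bigcap; apply: closed_bigcup.
      exact: finite_setIl.
    by move=> V [BV _]; apply: open_closedC; exact: B_open.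
  apply/seteqP; split=> [_ -> V []//|y By].
  apply: contrapT => /eqP; rewrite eq_sym => /X_accessible[W [oW xW yW]].
  have [|V [BV Vx] VW] := B_nbhs x W.
    by apply: open_nbhs_nbhs; split=> //; exact/set_mem.
  by move/set_mem: yW; apply; apply: VW; exact: By.
pose U (u : option X) := if u is Some x then [set x] else setT.
apply: (@dense_completely_metrizable_of_tree R X (option X) setT U
  (fun u v => exists2 x, v = Some x & U u x) None) => //.
- by move=> u _ _ [x -> Ux]; split=> [//||_ ->//]; exact: point_open.
- by move=> u W _ oW [x Wx] WU; exists (Some x); split;
    [exists x => //; exact: WU|exists x|move=> _ ->].
- move=> b b0 bE; have [x b1 _] := bE 0%N; exists x.
  have bx n : b n.+1 = Some x.
    by elim: n => [//|n IH]; have [y ->] := bE n.+1; rewrite IH /= => ->.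
  split=> [[|n]|W xW]; rewrite ?b0 ?bx //.
  by exists 1%N; rewrite b1 => _ ->; exact: nbhs_singleton.
Qed.

Hypothesis B_infinite : infinite_set B.
Hypothesis X_regular : regular_space X.
Hypothesis X_piotrowski : piotrowski (baire_metrizable_density_le R B) X.

Lemma infinite_basis_completely_metrizable :
  exists2 A : set X, dense A & completely_metrizable R (set_type A).
Proof.
(* A node is a position t, its level k, and the dense sets G of positions to be
   met. The root carries no such sets: they are chosen at level 1, together
   with a position where exists_residually_convergent_extension applies, and a
   node of level k + 2 lies in the k-th of them. *)
pose node : Type := seq (set X) * nat * (nat -> set (seq (set X))).
pose U (u : node) := s u.1.1.
pose ok : set node := [set u | position s B u.1.1 /\
  (u.1.2 <> 0%N -> dense_below s B u.1.1 u.2)].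
pose child (u v : node) := [/\ position s B v.1.1, prefix u.1.1 v.1.1,
  (size u.1.1 < size v.1.1)%N, v.1.2 = u.1.2.+1 &
  if u.1.2 is k.+1 then v.2 = u.2 /\ u.2 k v.1.1 else
    dense_below s B v.1.1 v.2 /\
    forall z, branch s B z -> through v.1.1 z ->
     (forall n, exists m, v.2 n (mkseq z m)) -> convergent s z].
have s_pos t : position s B t -> (0 < size t)%N -> s t !=set0.
  move=> tp t0; have [_ st _] := position_legal s_strategy tp; apply: st.
  by have [/(_ 0%N t0)[_ [x _] _] _] := tp; exists x.
apply: (@dense_completely_metrizable_of_tree R X node ok U child
  ([::], 0%N, fun=> set0)) => //.
- by have [] := s_strategy.
- move=> [[t k] G] [[t' k'] G'] [/= tp tG] [/= t'p tt' szt ->{k'} tt'k].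
  have [ot' _ st'] := position_legal s_strategy t'p.
  split=> //; last exact: st'.
  split=> //= _; case: k tG tt'k => [_ [] //|k tG [-> _]] n t'' t''p t't''.
  by apply: tG => //; exact: prefix_trans tt' t't''.
- move=> [[t k] G] W [/= tp tG] oW W0 Wt.
  have [t1 [t1p tt1 szt t1W]] := position_refine s_strategy B_basis tp oW W0 Wt.
  suff [t2 [G2 [t2p t12 tG2]]] : exists t2 G2,
    [/\ position s B t2, prefix t1 t2 &
    if k is k'.+1 then G2 = G /\ G k' t2 else dense_below s B t2 G2 /\
      forall z, branch s B z -> through t2 z ->
      (forall n, exists m, G2 n (mkseq z m)) -> convergent s z].
    have szt2 := leq_trans szt (size_prefix t12).
    exists (t2, k.+1, G2); split; rewrite /child /U /=.
    + by split=> //; exact: prefix_trans tt1 t12.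
    + by apply: s_pos => //; exact: leq_trans szt2.
    + have [_ _ /(_ _ t12) t21] := position_legal s_strategy t2p.
      exact: subset_trans t21 t1W.
  case: k tG {Wt} => [_|k tG].
    have [t2 [G2 [t2p t12 dG2 cG2]]] :=
      exists_residually_convergent_extension s_winning B_basis B_infinite
        X_regular X_piotrowski t1p.
    by exists t2, G2.
  by have [//|t2 [t2p t12 Gt2]] := tG _ k _ t1p tt1; exists t2, G.
move=> b b0 bE.
pose t n := (b n).1.1; pose G := (b 1%N).2.
have b_level n : (b n).1.2 = n.
  by elim: n => [|n IH]; [rewrite b0|have [_ _ _ -> _] := bE n; rewrite IH].
have b_G n : (b n.+1).2 = G.
  elim: n => // n <-; have [_ _ _ _] := bE n.+1.
  by rewrite b_level => -[].
have t_prefix m n : (m <= n)%N -> prefix (t m) (t n).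
  move=> /subnK <-; elim: (n - m)%N => [|k IH]; first exact: prefix_refl.
  by have [_ + _ _ _] := bE (k + m)%N; exact: prefix_trans.
have t_size n : (n <= size (t n))%N.
  elim: n => // n IH; have [_ _ + _ _] := bE n; exact: leq_ltn_trans.
have t_position n : position s B (t n).
  case: n => [|n]; last by have [] := bE n.
  by rewrite /t b0.
(* The positions of a branch of nodes are the prefixes of one play z; position
   t (i + 1) is long enough to contain its i-th move. *)
pose z i := nth set0 (t i.+1) i.
have prefix_nth m n i : (m <= n)%N -> (i < size (t m))%N ->
    nth set0 (t m) i = nth set0 (t n) i.
  by move=> /t_prefix /prefixP[r ->] im; rewrite nth_cat im.
have z_through n : through (t n) z.
  apply: (@eq_from_nth _ set0); rewrite size_mkseq// => i it.
  rewrite nth_mkseq// /z; have [ni|/ltnW ni] := leqP n i.+1.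
    exact/esym/prefix_nth.
  by apply: prefix_nth => //; exact: t_size.
have s_z n m : (m <= n)%N -> s (t n) `<=` s (mkseq z m).
  move=> mn; have [_ _] := position_legal s_strategy (t_position n).
  apply; rewrite -(z_through n); apply: prefix_mkseq.
  exact: leq_trans mn (t_size n).
have z_branch : branch s B z.
  move=> n; split; last first.
    have [_] := t_position n.+1; apply; apply: mem_nth; exact: t_size.
  have [tL _] := t_position n.
  have {}tL : beta_legal s z (size (t n)).
    apply: beta_legal_eq tL => i it; exact: through_nth (z_through n) it.
  by move=> i iltn; apply: tL; exact: leq_trans iltn (t_size n).
have [x [xz xbase]] : convergent s z.
  have [_ _ _ _] := bE 0%N; rewrite b_level => -[_]; apply=> //.
    exact: z_through.
  move=> n; exists (size (t n.+2)); rewrite (z_through n.+2).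
  by have [_ _ _ _] := bE n.+1; rewrite b_level => -[_]; rewrite b_G.
exists x; split=> [n|W /xbase[n nW]].
  by have := xz (size (t n)); rewrite (z_through n).
exists n; exact: subset_trans (s_z n n (leqnn n)) nW.
Qed.

End choquet_to_metrizable.

(** * From complete metrics to winning strategies *)

Section metrizable_to_choquet.
Context (R : realType) (X : topologicalType) (A : set X).
Context (M : metricType R) (h : set_type A -> M) (g : M -> set_type A).
Hypothesis X_regular : regular_space X.
Hypothesis A_dense : dense A.
Hypothesis M_complete : complete_metric M.
Hypotheses (hK : cancel h g) (h_cont : continuous h) (g_cont : continuous g).
Import Order.TTheory GRing.Theory Num.Theory.
Local Open Scope ring_scope.

Let shrink n (V : set X) : exists U : set X, open V -> V !=set0 ->
  [/\ open U, U !=set0, closure U `<=` V &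
   exists c : M,
     forall a : set_type A, U (set_val a) -> ball c n.+1%:R^-1 (h a)].
Proof.
have [[oV V0]|nV] := pselect (open V /\ V !=set0); last first.
  by exists set0 => oV V0; case: nV.
have [x [Vx Ax]] := A_dense V0 oV.
pose a : set_type A := exist _ x (mem_set Ax).
have [W xW WV] := X_regular (open_nbhs_nbhs (conj oV Vx)).
have : nbhs a (h @^-1` ball (h a) n.+1%:R^-1).
  by apply: h_cont; apply: nbhsx_ballx; rewrite invr_gt0.
move=> /nbhs_set_typeP[W' xW' W'h] => /=.
have : nbhs x (W `&` W') by exact: filterI.
rewrite nbhsE => -[U [oU Ux] UWW']; exists U => _ _; split=> //.
- by exists x.
- by apply: subset_trans WV; apply: closureS => y /UWW'[].
- by exists (h a) => b /UWW'[_ W'b]; exact: W'h.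
Qed.

(** The diameters of alpha's answers on A tend to 0 and the closure of each
    answer lies in the preceding move of beta, so points of A picked in the
    answers converge, in A and thus in X, to a point common to all moves. *)
Lemma choquet_of_dense_complete : choquet X.
Proof.
have /choice[step stepP] : forall u : nat * set X, _ := fun u => shrink u.1 u.2.
pose s t : set X := if t is V :: t' then step (size t', last V t') else setT.
have sS V n : s (mkseq V n.+1) = step (n, V n).
  rewrite mkseqS; have := size_mkseq V n; case: (mkseq V n) => [<-//|W t <-] /=.
  by rewrite last_rcons size_rcons.
have s_strategy : alpha_strategy s.
  split=> // V n VL; rewrite sS.
  have [oV V0 _] := VL n (ltnSn n).
  have [oU U0 cU _] := stepP (n, V n) oV V0; split=> //.
  by move=> x Ux; apply/cU/subset_closure.
exists s; split=> // V VL.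
have sub n m : (m <= n)%N -> s (mkseq V n) `<=` s (mkseq V m).
  by move=> mn; have [_ _] := strategy_legal s_strategy (VL n); exact.
have /choice[a aP] : forall n, exists a : set_type A,
    s (mkseq V n.+1) (set_val a).
  move=> n; have [_ sS'] := s_strategy; have [os s0 _] := sS' V n (VL n.+1).
  have [x [sx Ax]] := A_dense s0 os; by exists (exist _ x (mem_set Ax)).
have a_in n k : (n <= k)%N -> s (mkseq V n.+1) (set_val (a k)).
  by move=> nk; apply: sub (aP k); rewrite ltnS.
have h_cauchy : cauchy (h \o a @ \oo).
  apply: cauchy_exP => e e0.
  have [n ne] : exists n : nat, n.+1%:R^-1 < e.
    exists (Num.truncn e^-1).
    by rewrite -[ltRHS]invrK ltf_pV2 ?posrE ?invr_gt0//; exact: truncnS_gt.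
  have [oV V0 _] := VL n.+1 n (ltnSn n).
  have [_ _ _ [c cP]] := stepP (n, V n) oV V0.
  exists c; exists n => // k /= nk; apply: (le_ball (ltW ne)).
  by apply: cP; rewrite -sS; exact: a_in.
have [l hl] := M_complete h_cauchy.
have al : a @ \oo --> g l.
  have := cvg_comp _ _ hl (g_cont (x := l)).
  by apply: cvg_trans; apply: near_eq_cvg; near=> k; rewrite /= hK.
exists (set_val (g l)) => n _.
have gl_closure : closure (s (mkseq V n.+1)) (set_val (g l)).
  move=> W glW; have : nbhs (g l) (set_val @^-1` W).
    by apply/nbhs_set_typeP; exists W.
  move=> /al [N _ NW]; exists (set_val (a (maxn n N))); split.
    by apply: a_in; exact: leq_maxl.
  by apply: NW => /=; exact: leq_maxr.
have [oV V0 Vs] := VL n.+1 n (ltnSn n).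
apply: Vs; have [_ _ + _] := stepP (n, V n) oV V0.
by apply; rewrite -sS.
Unshelve. all: by end_near. Qed.

End metrizable_to_choquet.

Theorem theorem7p3 (R : realType) (X : topologicalType) :
  tychonoff_space X ->
  piotrowski (baire_metrizable_density_le R (weight X)) X ->
  ((exists2 A : set X, dense A & completely_metrizable R (set_type A)) <->
   choquet X).
Proof.
move=> [X_accessible /(@completely_regular_regular R X) X_regular] X_piotrowski.
split=> [[A A_dense [M M_complete [h [g [hK _ h_cont g_cont]]]]]|[s s_winning]].
  exact: (choquet_of_dense_complete X_regular A_dense M_complete hK h_cont).
have [B_basis _] := weightP X.
have [Bfin|Binf] := pselect (finite_set (weight X)).
  exact: (finite_basis_completely_metrizable R s_winning B_basis).
exact: (infinite_basis_completely_metrizable s_winning B_basis).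
Qed.
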